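(* Let $\nu>-1$ and let $P_n^\nu(x)=\sum_{k=0}^n a_{n,k}x^k$, $n\in\mathbb{N}_0$, be the sequence of orthonormal polynomials with positive leading coefficients $a_{n,n}>0$ for the weight $e^{-x}\rho_\nu(x)$ on $(0,\infty)$, i.e. $\int_0^\infty P_m^\nu(x)P_n^\nu(x)e^{-x}\rho_\nu(x)\,dx=\delta_{n,m}$. Then, with the determinants $D_n$, $D_{n,k}$ and the numbers $d_{k,m}$ defined in the context, the coefficients are given explicitly by $$a_{n,k}=-a_{n,0}\,\frac{D_{n,k}}{D_n},\qquad k=1,\dots,n,$$ $$a_{n,0}=\pm D_n\left[\frac{\Gamma(1+\nu)}{D_{n,n}\sum_{k=0}^n D_{n,k}\,(n+k)!\,d_{0,n+k}}\right]^{1/2},$$ where the sign is the one for which $a_{n,n}>0$. Moreover, the sequence satisfies the three-term recurrence relation $$xP_n^\nu(x)=A_{n+1}P_{n+1}^\nu(x)+B_nP_n^\nu(x)+A_nP_{n-1}^\nu(x),\qquad n\in\mathbb{N}_0,\quad P_{-1}^\nu\equiv0,$$ where $$A_{n+1}=\frac{a_{n,0}\,D_{n+1}\,D_{n,n}}{a_{n+1,0}\,D_n\,D_{n+1,n+1}},\qquad B_n=\frac{D_{n,n-1}}{D_{n,n}}-\frac{D_{n+1,n}}{D_{n+1,n+1}}.$$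
   Context: $\rho_\nu(x)=2x^{\nu/2}K_\nu(2\sqrt x)=\int_0^\infty t^{\nu-1}e^{-t-x/t}\,dt$ for $x>0$, $\nu\in\mathbb{R}$, where $K_\nu$ is the modified Bessel (Macdonald) function. $\Psi(a,b;z)$ is the Tricomi confluent hypergeometric function, $\Psi(a,b;z)=\frac1{\Gamma(a)}\int_0^\infty e^{-zt}t^{a-1}(1+t)^{b-a-1}dt$ for $a,z>0$; $(a)_k$ is the Pochhammer symbol. For $k,m\in\mathbb{N}_0$, $$d_{k,m}=\Gamma(1+\nu)\sum_{r=0}^k(-1)^{k+r}\binom{k}{r}\frac{(1+\nu)_k}{(1+\nu)_r}\,\Gamma(1+\nu+k+r+m)\,\Psi(1+m,\,1-\nu-k-r;\,1).$$ For $n\ge1$, $D_n$ is the determinant of the $n\times n$ matrix whose entry in row $m$ ($m=0,\dots,n-1$) and column $j$ ($j=1,\dots,n$) is $d_{j,m}$. For $1\le k\le n$, $D_{n,k}$ is the determinant obtained from $D_n$ by replacing its column $j=k$ by the column $(d_{0,0},d_{0,1},\dots,d_{0,n-1})^T$; and $D_{n,0}:=-D_n$. Conventions for $n=0$: $D_0:=1$, $D_{0,0}:=-1$, $D_{0,-1}:=0$. *)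

(* Defs.v *)
From HB Require Import structures.
From mathcomp Require Import all_boot all_order all_algebra.
From mathcomp Require Import all_classical all_reals all_analysis.

Set Implicit Arguments.
Unset Strict Implicit.
Unset Printing Implicit Defensive.

Import Order.TTheory GRing.Theory Num.Theory.
Import numFieldNormedType.Exports.

Local Open Scope classical_set_scope.
Local Open Scope ring_scope.

Section SpecialFunctions.
Context {R : realType}.
Local Notation mu := (@lebesgue_measure R).

(* [\int] is the real-valued Lebesgue integral, which is 0 by convention when
   the integral is infinite; every integral below is only used for parameters
   at which it converges absolutely. *)

Definition Gamma (a : R) : R :=
  \int[mu]_(t in `]0, +oo[) (t `^ (a - 1) * expR (- t)).

Definition tricomi (a b z : R) : R :=
  (Gamma a)^-1 *
  \int[mu]_(t in `]0, +oo[)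
    (expR (- (z * t)) * t `^ (a - 1) * (1 + t) `^ (b - a - 1)).

(* rho nu x = 2 x^(nu/2) K_nu(2 sqrt x) for x > 0, K_nu being the Macdonald
   function; this is its integral representation. *)
Definition rho (nu x : R) : R :=
  \int[mu]_(t in `]0, +oo[) (t `^ (nu - 1) * expR (- t - x / t)).

Definition pochhammer (a : R) (k : nat) : R := \prod_(i < k) (a + i%:R).

Definition orthonormal_for (w : R -> R) (P : nat -> {poly R}) : Prop :=
  forall m n : nat,
    \int[mu]_(x in `]0, +oo[) ((P m).[x] * (P n).[x] * w x) = (n == m)%:R.

Definition dcoef (nu : R) (k m : nat) : R :=
  Gamma (1 + nu) *
  \sum_(r < k.+1)
    ((-1) ^+ (k + r) * 'C(k, r)%:R
     * (pochhammer (1 + nu) k / pochhammer (1 + nu) r)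
     * Gamma (1 + nu + k%:R + r%:R + m%:R)
     * tricomi (1 + m%:R) (1 - nu - k%:R - r%:R) 1).

(* Columns are indexed from 0 here, so column [j] holds the d_{j+1,m}. *)
Definition Ddet (nu : R) (n : nat) : R :=
  \det (\matrix_(m < n, j < n) dcoef nu j.+1 m).

(* D_{n,k}; the index [k] is an integer so that D_{0,-1} = 0 makes sense. Only
   0 <= k <= n and (n, k) = (0, -1) are meaningful. *)
Definition Dcol (nu : R) (n : nat) (k : int) : R :=
  match k with
  | Posz 0 => - Ddet nu n
  | Posz k'.+1 =>
      \det (\matrix_(m < n, j < n)
              if j == k' :> nat then dcoef nu 0 m else dcoef nu j.+1 m)
  | Negz _ => 0
  end.

Definition radicand (nu : R) (n : nat) : R :=
  Gamma (1 + nu) /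
  (Dcol nu n n%:Z *
   \sum_(k < n.+1) (Dcol nu n k%:Z * (n + k)`!%:R * dcoef nu 0 (n + k))).

(* P_{n-1}, with P_{-1} = 0. *)
Definition prevp (P : nat -> {poly R}) (n : nat) : {poly R} :=
  if n is n'.+1 then P n' else 0.

End SpecialFunctions.

(* Main.v *)
(**
  Write mu_j for the j-th moment of the weight e^{-x} rho_nu(x).  The point is
  that d_{k,m} = Gamma(1+nu) mu_{k+m} / m!, so that up to row scaling D_n is the
  Hankel determinant of the weight x e^{-x} rho_nu(x), and the formulas are
  Cramer's rule for the orthogonality relations sum_k a_{n,k} mu_{k+m} = 0.

  With J(alpha,m) the integral of s^alpha e^{-s} (1+s)^{-m-1} over (0,oo),
  Tonelli gives mu_j = j! J(nu+j,j) and m! J(alpha,m) = Gamma(alpha+1) K(alpha,m)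
  where K(alpha,m)/m! is the Tricomi function.  Splitting 1+s in both forms and
  using Gamma(a+1) = a Gamma(a) yields a three-term relation for m! J(alpha,m),
  from which the formula for d_{k,m} follows by induction on k.
*)

Require Import Defs.
From HB Require Import structures.
From mathcomp Require Import all_boot all_order all_algebra.
From mathcomp Require Import all_classical all_reals all_analysis.
From mathcomp Require Import measurable_realfun ring.

Set Implicit Arguments.
Unset Strict Implicit.
Unset Printing Implicit Defensive.

Import Order.TTheory GRing.Theory Num.Theory.
Import numFieldNormedType.Exports.

Local Open Scope classical_set_scope.
Local Open Scope ring_scope.

(** * Tonelli on rectangles and two elementary tail integrals *)

Section IteratedAndTailIntegrals.
Context {R : realType}.
Local Notation mu := (@lebesgue_measure R).

(** Extending the integrand by zero off the rectangle reduces this to Tonelli on the whole plane.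
    Measurability of the partial integrals is kept in the conclusion because [weight_moment] derives
    the measurability of the weight from it. *)
Lemma tonelli_rect (A B : set R) (f : R -> R -> R) :
  measurable A -> measurable B ->
  measurable_fun [set: R * R] (fun z => f z.1 z.2) ->
  (forall x y, A x -> B y -> 0 <= f x y) ->
  [/\ measurable_fun A (fun x => \int[mu]_(y in B) (f x y)%:E)%E,
      measurable_fun B (fun y => \int[mu]_(x in A) (f x y)%:E)%E &
  (\int[mu]_(x in A) \int[mu]_(y in B) (f x y)%:E =
   \int[mu]_(y in B) \int[mu]_(x in A) (f x y)%:E)%E].
Proof.
move=> mA mB mf f0.
pose g : R * R -> \bar R := (fun z => (f z.1 z.2)%:E) \_ (A `*` B).
have mg : measurable_fun setT g.
  apply/(measurable_restrictT _ _).1; first exact: measurableX.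
  by apply: measurable_funTS; exact/measurable_EFinP.
have g0 z : (0 <= g z)%E.
  rewrite /g patchE; case: ifPn => //; rewrite inE => -[? ?].
  by rewrite lee_fin f0.
have gA x : ((fun x => \int[mu]_(y in B) (f x y)%:E) \_ A)%E x = (\int[mu]_y g (x, y))%E.
  rewrite patchE; case: ifPn => [/set_mem xA|/negP xA].
    rewrite integral_mkcond; apply: eq_integral => y _.
    by rewrite /g !patchE in_setX (mem_set xA).
  rewrite integral0_eq// => y _; rewrite /g patchE ifF// in_setX.
  by apply/negP => /andP[].
have gB y : ((fun y => \int[mu]_(x in A) (f x y)%:E) \_ B)%E y = (\int[mu]_x g (x, y))%E.
  rewrite patchE; case: ifPn => [/set_mem yB|/negP yB].
    rewrite integral_mkcond; apply: eq_integral => x _.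
    by rewrite /g !patchE in_setX (mem_set yB) andbT.
  rewrite integral0_eq// => x _; rewrite /g patchE ifF// in_setX.
  by apply/negP => /andP[].
split.
- apply/(measurable_restrictT _ mA); rewrite (funext gA).
  exact: (@measurable_fun_fubini_tonelli_F _ _ _ _ R mu g).
- apply/(measurable_restrictT _ mB); rewrite (funext gB).
  exact: (@measurable_fun_fubini_tonelli_G _ _ _ _ R mu g).
- rewrite integral_mkcond [RHS]integral_mkcond (funext gA) (funext gB).
  exact: (@fubini_tonelli _ _ _ _ R mu mu g).
Qed.

Lemma integral_expR_tail (c t : R) : 0 < t ->
  (\int[mu]_(u in `[c, +oo[) (expR (- (u * t)))%:E = (expR (- (c * t)) / t)%:E)%E.
Proof.
move=> t0.
have dN (x : R) : is_derive x 1 (fun u => - (u * t)) (- t).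
  by apply: is_derive_eq; rewrite /GRing.scale/=; ring.
have dE (x : R) : is_derive x 1 (fun u => expR (- (u * t))) (- t * expR (- (x * t))).
  by apply: is_derive_eq; rewrite /GRing.scale/=; ring.
have dF (x : R) : is_derive x 1 (fun u => - (expR (- (u * t)) / t)) (expR (- (x * t))).
  by apply: is_derive_eq; rewrite /GRing.scale/=; field; rewrite gt_eqF.
have cE : continuous (fun u : R => expR (- (u * t))).
  by move=> x; exact/differentiable_continuous/derivable1_diffP/ex_derive.
have cF : continuous (fun u : R => - (expR (- (u * t)) / t)).
  by move=> x; exact/differentiable_continuous/derivable1_diffP/ex_derive.
rewrite (@ge0_continuous_FTC2y _ _ (fun u : R => - (expR (- (u * t)) / t)) _ 0).
- by rewrite sub0e -EFinN opprK.
- by move=> x _; exact: expR_ge0.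
- exact: continuous_subspaceT.
- rewrite -[X in _ --> X]oppr0; apply: cvgN; rewrite -(mul0r t^-1).
  apply: cvgM; last exact: cvg_cst.
  apply: (@cvg_comp _ _ _ (fun u : R => u * t) (fun z : R => expR (- z)) _ (pinfty_nbhs R)).
    by apply: (gt0_cvgMly t0 (f := id)); exact: cvg_id.
  exact: cvgr_expR.
- by move=> x _; have ? := dF x; exact: ex_derive.
- exact/cvg_at_right_filter/cF.
- by move=> x _; rewrite derive1E; exact: derive_val.
Qed.

Lemma integral_powR_tail (c a : R) : 0 < c -> 0 < a ->
  (\int[mu]_(u in `[c, +oo[) (u `^ (- (a + 1)))%:E = (c `^ (- a) / a)%:E)%E.
Proof.
move=> c0 a0.
have dF (x : R) : 0 < x -> is_derive x 1 (fun u => - (u `^ (- a) / a)) (x `^ (- (a + 1))).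
  move=> x0; have ? := is_derive1_powR (- a) x0.
  apply: is_derive_eq; rewrite /GRing.scale/= mulr0 add0r opprD.
  by field; rewrite gt_eqF.
have cP b (x : R) : 0 < x -> {for x, continuous (fun u : R => u `^ b)}.
  move=> x0; have ? := is_derive1_powR b x0.
  exact/differentiable_continuous/derivable1_diffP/ex_derive.
rewrite (@ge0_continuous_FTC2y _ _ (fun u : R => - (u `^ (- a) / a)) _ 0).
- by rewrite sub0e -EFinN opprK.
- by move=> x _; exact: powR_ge0.
- apply/continuous_within_itvcyP; split => [x|].
    by rewrite in_itv/= andbT => cx; exact/cP/(lt_trans c0).
  exact/cvg_at_right_filter/cP.
- rewrite -[X in _ --> X]oppr0; apply: cvgN; rewrite -(mul0r a^-1).
  apply: cvgM; last exact: cvg_cst.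
  (* The antiderivative vanishes at infinity: for u > 0 the power is e^{-a ln u}, and ln u tends to
     infinity. *)
  apply: (@cvg_trans _ ((expR (- (a * ln u))) @[u --> +oo])).
    by apply: near_eq_cvg; near=> u; rewrite /powR gt_eqF// mulNr.
  apply: (@cvg_comp _ _ _ (fun u : R => a * ln u) (fun z : R => expR (- z)) _ (pinfty_nbhs R)).
    apply: (gt0_cvgMry a0 (f := @ln R)).
    apply/cvgryPge => M; near=> u.
    rewrite -ler_expR lnK; first by near: u; exact: nbhs_pinfty_ge.
    by rewrite posrE; near: u; exact: nbhs_pinfty_gt.
  exact: cvgr_expR.
- by move=> x cx; have ? := dF x (lt_trans c0 cx); exact: ex_derive.
- by apply: cvg_at_right_filter; apply: cvgN; apply: cvgM; [exact: cP|exact: cvg_cst].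
- move=> x; rewrite in_itv/= andbT => cx; have ? := dF x (lt_trans c0 cx).
  by rewrite derive1E; exact: derive_val.
Unshelve. all: by end_near.
Qed.
End IteratedAndTailIntegrals.

(** * The Gamma integral: scaling, functional equation, finiteness, positivity *)

Section GammaIntegral.
Context {R : realType}.
Local Notation mu := (@lebesgue_measure R).

Lemma measurable_powR_comp d (T : measurableType d) (D : set T) (f : T -> R) p :
  measurable_fun D f -> measurable_fun D (fun x => f x `^ p).
Proof. exact: (measurableT_comp (@measurable_powR R p)). Qed.

Lemma measurable_expR_comp d (T : measurableType d) (D : set T) (f : T -> R) :
  measurable_fun D f -> measurable_fun D (fun x => expR (f x)).
Proof. exact: (measurableT_comp (@measurable_expR R)). Qed.

(** Extended-real valued, so that the identities below can be proved before the integral is known to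
    be finite; the rate c is the parameter that inner integrals of double integrals produce. *)
Definition egamma (c a : R) : \bar R :=
  (\int[mu]_(t in `]0%R, +oo[) (t `^ (a - 1) * expR (- (c * t)))%:E)%E.

Lemma egamma_integrand_measurable (c p : R) (D : set R) :
  measurable_fun D (fun t : R => t `^ p * expR (- (c * t))).
Proof.
apply: measurable_funTS; apply: measurable_funM; first exact: measurable_powR.
by apply: measurable_expR_comp; apply: measurableT_comp => //; exact: measurable_funM.
Qed.

Lemma egamma_ge0 (c a : R) : (0 <= egamma c a)%E.
Proof.
by apply: integral_ge0 => t _; rewrite lee_fin mulr_ge0 ?powR_ge0 ?expR_ge0.
Qed.

(* Writing t^(a-1) e^{-ct} as the integral of t^a e^{-ut} over u >= c removes the
   singularity at 0, so no integration by parts on (0,oo) is needed. *)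
Lemma egamma_tail (c a : R) : 0 < a ->
  (egamma c a = \int[mu]_(u in `[c, +oo[) egamma u (a + 1))%E.
Proof.
move=> a0; rewrite /egamma.
have [||||_ _ ->] := @tonelli_rect R `[c, +oo[ `]0%R, +oo[
    (fun u t => t `^ (a + 1 - 1) * expR (- (u * t))) _ _ _ _ => //.
- apply: measurable_funM; first exact: measurable_powR_comp.
  by apply: measurable_expR_comp; apply: measurableT_comp => //; exact: measurable_funM.
- by move=> x y _ _; rewrite mulr_ge0 ?powR_ge0 ?expR_ge0.
apply: eq_integral => t; rewrite inE/= in_itv/= andbT => t0.
under eq_integral do rewrite EFinM.
rewrite ge0_integralZl//=; last 2 first.
- apply/measurable_EFinP; apply: measurable_expR_comp.
  by apply: measurableT_comp => //; exact: measurable_funM.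
- by rewrite lee_fin powR_ge0.
rewrite integral_expR_tail// -EFinM addrK mulrCA mulrC; congr ((_ * _)%:E).
by rewrite powRB ?powRr1 ?ltW// (lt0r_neq0 t0) implybT.
Qed.

(** Change of variable t -> ct. Taking p > 0 makes the integrand continuous up to 0, as the
    substitution theorem on the closed half-line requires; [egamma_shift] then reaches every
    positive exponent. *)
Lemma egamma_substitution (c p : R) : 0 < c -> 0 < p ->
  (egamma 1 (p + 1) = (c `^ (p + 1))%:E * egamma c (p + 1))%E.
Proof.
move=> c0 p0; rewrite /egamma addrK.
have E (k : R) : (\int[mu]_(t in `]0%R, +oo[) (t `^ p * expR (- (k * t)))%:E =
    \int[mu]_(t in `[0%R, +oo[) (t `^ p * expR (- (k * t)))%:E)%E.
  apply: integral_itv_obnd_cbnd; apply/measurable_EFinP.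
  exact: egamma_integrand_measurable.
rewrite !E -{1}(mulr0 c).
have dF (x : R) : is_derive x 1 (fun t : R => c * t) c.
  by apply: is_derive_eq; rewrite /GRing.scale/=; ring.
have F'E : derive1 (fun t : R => c * t) = cst c.
  by apply/funext => x; rewrite derive1E; have ? := dF x; exact: derive_val.
have Fc : continuous (fun t : R => c * t).
  by move=> x; have ? := dF x; exact/differentiable_continuous/derivable1_diffP/ex_derive.
have dN (x : R) : is_derive x 1 (fun u : R => - (1 * u)) (- 1).
  by apply: is_derive_eq; rewrite /GRing.scale/=; ring.
have cE : continuous (fun u : R => expR (- (1 * u))).
  move=> x; have ? := dN x.
  exact/differentiable_continuous/derivable1_diffP/ex_derive.
rewrite (@increasing_ge0_integration_by_substitutiony _ (fun t : R => c * t)).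
- rewrite -ge0_integralZl//=; last 3 first.
  + by apply/measurable_EFinP; exact: egamma_integrand_measurable.
  + by move=> x _; rewrite lee_fin mulr_ge0 ?powR_ge0 ?expR_ge0.
  + by rewrite lee_fin powR_ge0.
  apply: eq_integral => t; rewrite inE/= in_itv/= andbT => t0; congr EFin.
  rewrite F'E !fctE /= mul1r powRM// ?ltW//.
  rewrite powRD ?powRr1 ?ltW//; first by ring.
  by rewrite (lt0r_neq0 c0) implybT.
- by move=> x y _ _ xy; rewrite ltr_pM2l.
- by move=> x _; rewrite F'E; exact: cst_continuous.
- by rewrite F'E; exact: is_cvg_cst.
- by rewrite F'E; exact: is_cvg_cst.
- split; first by move=> x _; have ? := dF x; exact: ex_derive.
  exact/cvg_at_right_filter/Fc.
- by apply: (gt0_cvgMry c0 (f := id)); exact: cvg_id.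
- rewrite mulr0; apply/continuous_within_itvcyP; split => [x|].
    rewrite in_itv/= andbT => x0; have ? := is_derive1_powR p x0.
    have cP : {for x, continuous (fun u : R => u `^ p)}.
      exact/differentiable_continuous/derivable1_diffP/ex_derive.
    by apply: cvgM; [exact: cP|exact: cE].
  rewrite powR0 ?gt_eqF//.
  by apply: cvgM; [exact: powR_cvg0|exact/cvg_at_right_filter/cE].
- by move=> x _; rewrite mulr_ge0 ?powR_ge0 ?expR_ge0.
Qed.

(** By [egamma_tail] the left side integrates [egamma u (a + 1)] over u >= c; scaling turns this
    into u^{-(a+1)} times a constant, and the tail of that power is explicit. The case c = 1 is the
    functional equation of Gamma. *)
Lemma egamma_shift (c a : R) : 0 < c -> 0 < a ->
  (egamma c a = (c `^ (- a) / a)%:E * egamma 1 (a + 1))%E.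
Proof.
move=> c0 a0; rewrite egamma_tail//.
under eq_integral => u.
  rewrite inE/= in_itv/= andbT => cu; have u0 := lt_le_trans c0 cu.
  have -> : egamma u (a + 1) = ((u `^ (- (a + 1)))%:E * egamma 1 (a + 1))%E.
    rewrite (egamma_substitution u0 a0) muleA -EFinM -powRD ?addNr ?powRr0 ?mul1e//.
    by rewrite (lt0r_neq0 u0) implybT.
  over.
rewrite ge0_integralZr//= ?egamma_ge0//.
- by rewrite integral_powR_tail.
- by apply/measurable_EFinP; apply: measurable_funTS; exact: measurable_powR.
- by move=> x _; rewrite lee_fin powR_ge0.
Qed.

Lemma egamma11 : egamma 1 1 = 1%E.
Proof.
rewrite /egamma subrr.
under eq_integral do rewrite powRr0 mul1r mulrC.
rewrite integral_itv_obnd_cbnd.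
  by rewrite integral_expR_tail// mul0r oppr0 expR0 divr1.
apply/measurable_EFinP; apply: measurable_expR_comp.
by apply: measurableT_comp => //; exact: measurable_funM.
Qed.

Lemma egammaS (a : R) : 0 < a -> egamma 1 (a + 1) = (a%:E * egamma 1 a)%E.
Proof.
move=> a0; rewrite (egamma_shift ltr01 a0) powR1 div1r muleA -EFinM divff ?gt_eqF//.
by rewrite mul1e.
Qed.

Lemma egamma_nat n : egamma 1 n.+1%:R = (n`!%:R)%:E.
Proof.
elim: n => [|n IH]; first exact: egamma11.
by rewrite -[in LHS]natr1 egammaS// IH -EFinM -natrM -factS.
Qed.

(** After a shift only [egamma 1 (a + 1)] matters. With an integer n >= a one has t^a <= 1 + t^n, so
    it is at most 0! + n!. *)
Lemma egamma_fin (c a : R) : 0 < c -> 0 < a -> egamma c a \is a fin_num.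
Proof.
move=> c0 a0; rewrite egamma_shift// fin_numM//.
rewrite ge0_fin_numE ?egamma_ge0//.
pose n := (Num.trunc a).+1.
have an : a <= n%:R by exact/ltW/truncnS_gt.
apply: (@le_lt_trans _ _ (egamma 1 1%:R + egamma 1 n.+1%:R)%E); last first.
  by rewrite !egamma_nat ltry.
rewrite /egamma -ge0_integralD//=; last 4 first.
- by move=> x _; rewrite lee_fin mulr_ge0 ?powR_ge0 ?expR_ge0.
- by apply/measurable_EFinP; exact: egamma_integrand_measurable.
- by move=> x _; rewrite lee_fin mulr_ge0 ?powR_ge0 ?expR_ge0.
- by apply/measurable_EFinP; exact: egamma_integrand_measurable.
apply: ge0_le_integral => //=.
- by move=> x _; rewrite lee_fin mulr_ge0 ?powR_ge0 ?expR_ge0.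
- by apply/measurable_EFinP; exact: egamma_integrand_measurable.
- apply: emeasurable_funD; by apply/measurable_EFinP; exact: egamma_integrand_measurable.
move=> x; rewrite in_itv/= andbT => x0.
rewrite -EFinD lee_fin -mulrDl ler_wpM2r ?expR_ge0// addrK subrr powRr0.
rewrite -natr1 addrK.
have [x1|/ltW x1] := leP x 1.
  apply: (@le_trans _ _ 1); last by rewrite lerDl powR_ge0.
  by rewrite -[leRHS](powRr0 x) ger_powR ?x0//= ltW.
apply: (@le_trans _ _ (x `^ n%:R)); last by rewrite lerDr.
by rewrite ler_powR.
Qed.

Lemma GammaE (a : R) : Gamma a = fine (egamma 1 a).
Proof.
by congr fine; apply: eq_integral => t _; rewrite mul1r.
Qed.

Lemma egammaE (c a : R) : 0 < c -> 0 < a -> egamma c a = (c `^ (- a) * Gamma a)%:E.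
Proof.
move=> c0 a0; rewrite egamma_shift// egammaS// muleA -EFinM divfK ?gt_eqF//.
by rewrite GammaE EFinM fineK// egamma_fin.
Qed.

Lemma GammaS (a : R) : 0 < a -> Gamma (a + 1) = a * Gamma a.
Proof. by move=> a0; rewrite !GammaE egammaS// fineM// egamma_fin. Qed.

Lemma Gamma_nat n : Gamma n.+1%:R = n`!%:R :> R.
Proof. by rewrite GammaE egamma_nat. Qed.

(** The functional equation passes to Gamma(a+1), whose integrand dominates e^{-t} on [1,oo) because
    t^a >= 1 there. *)
Lemma Gamma_gt0 (a : R) : 0 < a -> 0 < Gamma a.
Proof.
move=> a0; rewrite -(pmulr_rgt0 _ a0) -GammaS// -lte_fin GammaE fineK ?egamma_fin ?addr_gt0//.
have e1 : (0 < (expR (- (1 * 1)) / 1 : R)%:E)%E by rewrite divr1 lte_fin expR_gt0.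
apply: (lt_le_trans e1); rewrite -integral_expR_tail//.
apply: (@le_trans _ _ (\int[mu]_(t in `[1%R, +oo[) (t `^ (a + 1 - 1) * expR (- (1 * t)))%:E)%E).
  apply: ge0_le_integral => //=.
  - apply/measurable_EFinP; apply: measurable_expR_comp.
    by apply: measurableT_comp => //; exact: measurable_funM.
  - by apply/measurable_EFinP; exact: egamma_integrand_measurable.
  move=> x; rewrite in_itv/= andbT => x1; rewrite lee_fin mulr1 mul1r ler_peMl ?expR_ge0//.
  by rewrite addrK -(powRr0 x) ler_powR// ltW.
apply: ge0_subset_integral => //=.
- by apply/measurable_EFinP; exact: egamma_integrand_measurable.
- by move=> x _; rewrite lee_fin mulr_ge0 ?powR_ge0 ?expR_ge0.
by move=> x /=; rewrite !in_itv/= !andbT => x1; exact: lt_le_trans ltr01 x1.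
Qed.
End GammaIntegral.

(** * The integrals J and K, and the moments of the weight *)

Section WeightMoments.
Context {R : realType}.
Local Notation mu := (@lebesgue_measure R).

Lemma gamma_integrable (c p : R) : 0 < c -> -1 < p ->
  mu.-integrable `]0, +oo[ (fun t => (t `^ p * expR (- (c * t)))%:E).
Proof.
move=> c0 p1; apply/integrableP; split.
  by apply/measurable_EFinP; exact: egamma_integrand_measurable.
have p0 : 0 < p + 1 by rewrite -ltrBlDr sub0r.
rewrite (@eq_integral _ _ _ mu _ (fun t => (t `^ (p + 1 - 1) * expR (- (c * t)))%:E)).
  by have := egamma_fin c0 p0; rewrite ge0_fin_numE// egamma_ge0.
move=> t _; rewrite /= addrK ger0_norm// mulr_ge0 ?powR_ge0 ?expR_ge0//.
Qed.

Definition Jfun (alpha : R) (m : nat) (s : R) : R :=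
  s `^ alpha * expR (- s) * (1 + s) `^ (- m.+1%:R).

(** The unsimplified [1 * t] and [1 + m%:R - 1] reproduce the integrand of [tricomi (1 + m%:R) b 1],
    so that in [dcoefE] only the last exponent has to be compared. *)
Definition Kfun (alpha : R) (m : nat) (t : R) : R :=
  expR (- (1 * t)) * t `^ (1 + m%:R - 1) * (1 + t) `^ (- (alpha + 1)).

Lemma measurable_Jfun alpha m (D : set R) : measurable_fun D (Jfun alpha m).
Proof.
apply: measurable_funTS; apply: measurable_funM.
  apply: measurable_funM; first exact: measurable_powR.
  exact: measurable_expR_comp.
by apply: measurable_powR_comp; exact: measurable_funD.
Qed.

Lemma measurable_Kfun alpha m (D : set R) : measurable_fun D (Kfun alpha m).
Proof.
apply: measurable_funTS; apply: measurable_funM.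
  apply: measurable_funM; last exact: measurable_powR.
  by apply: measurable_expR_comp; apply: measurableT_comp => //; exact: measurable_funM.
by apply: measurable_powR_comp; exact: measurable_funD.
Qed.

Lemma Jfun_ge0 alpha m s : 0 <= Jfun alpha m s.
Proof. by rewrite !mulr_ge0 ?powR_ge0 ?expR_ge0. Qed.

Lemma Kfun_ge0 alpha m s : 0 <= Kfun alpha m s.
Proof. by rewrite !mulr_ge0 ?powR_ge0 ?expR_ge0. Qed.

Lemma ge0_integral_EFinZl (c : R) (f : R -> R) : 0 <= c ->
  measurable_fun (`]0, +oo[ : set R) f -> (forall x, 0 <= f x) ->
  (c%:E * \int[mu]_(x in `]0%R, +oo[) (f x)%:E =
   \int[mu]_(x in `]0%R, +oo[) (c * f x)%:E)%E.
Proof.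
move=> c0 mf f0; rewrite -ge0_integralZl//.
- exact/measurable_EFinP.
- by move=> x _; rewrite lee_fin.
Qed.

Lemma powRN_le1 (x p : R) : 1 <= x -> 0 <= p -> x `^ (- p) <= 1.
Proof. by move=> x1 p0; rewrite -(powRr0 x) ler_powR// oppr_le0. Qed.

Lemma Jfun_integrable alpha m : -1 < alpha ->
  mu.-integrable `]0, +oo[ (EFin \o Jfun alpha m).
Proof.
move=> h; apply: (le_integrable _ _ _ (gamma_integrable ltr01 h)) => //.
  by apply/measurable_EFinP; exact: measurable_Jfun.
move=> x /=; rewrite in_itv/= andbT => x0.
rewrite !ger0_norm ?Jfun_ge0 ?mulr_ge0 ?powR_ge0 ?expR_ge0// lee_fin mul1r.
by rewrite ler_piMr ?mulr_ge0 ?powR_ge0 ?expR_ge0// powRN_le1// lerDl ltW.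
Qed.

Lemma Kfun_integrable alpha m : -1 < alpha ->
  mu.-integrable `]0, +oo[ (EFin \o Kfun alpha m).
Proof.
move=> h; have m1 : -1 < m%:R :> R by rewrite (lt_le_trans (ltrN10 R)).
apply: (le_integrable _ _ _ (gamma_integrable ltr01 m1)) => //.
  by apply/measurable_EFinP; exact: measurable_Kfun.
move=> x /=; rewrite in_itv/= andbT => x0.
rewrite !ger0_norm ?Kfun_ge0 ?mulr_ge0 ?powR_ge0 ?expR_ge0// lee_fin.
rewrite /Kfun (_ : 1 + m%:R - 1 = m%:R); last by ring.
rewrite [_ `^ m%:R * _]mulrC ler_piMr ?mulr_ge0 ?powR_ge0 ?expR_ge0//.
by rewrite powRN_le1// ?lerDl ?ltW// -ltrBlDr sub0r.
Qed.

Definition Jint alpha m : R := \int[mu]_(s in `]0, +oo[) Jfun alpha m s.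
Definition Kint alpha m : R := \int[mu]_(t in `]0, +oo[) Kfun alpha m t.

Lemma JintE alpha m : -1 < alpha ->
  ((Jint alpha m)%:E = \int[mu]_(s in `]0%R, +oo[) (Jfun alpha m s)%:E)%E.
Proof. by move=> h; rewrite fineK//; apply: integrable_fin_num => //; exact: Jfun_integrable. Qed.

Lemma KintE alpha m : -1 < alpha ->
  ((Kint alpha m)%:E = \int[mu]_(s in `]0%R, +oo[) (Kfun alpha m s)%:E)%E.
Proof. by move=> h; rewrite fineK//; apply: integrable_fin_num => //; exact: Kfun_integrable. Qed.

(** Multiply and divide the integrand by 1 + s. [Kint_split] does the same with 1 + t, which there
    raises alpha in both terms. *)
Lemma Jint_split alpha m : -1 < alpha ->
  Jint alpha m = Jint alpha m.+1 + Jint (alpha + 1) m.+1.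
Proof.
move=> h; have h1 : -1 < alpha + 1 by rewrite (lt_trans h)// ltrDl.
rewrite /Jint -RintegralD//; [|exact: Jfun_integrable..].
apply: eq_Rintegral => s; rewrite inE/= in_itv/= andbT => s0.
rewrite /Jfun -[m.+2%:R]natr1 opprD !powRD ?powRr1 ?powR_inv1 ?(ltW s0)//.
- by field; rewrite gt_eqF// addr_gt0.
- by rewrite addr_ge0// ltW.
- by rewrite (lt0r_neq0 s0) implybT.
- by rewrite lt0r_neq0 ?implybT// addr_gt0.
Qed.

Lemma Kint_split alpha m : -1 < alpha ->
  Kint alpha m = Kint (alpha + 1) m + Kint (alpha + 1) m.+1.
Proof.
move=> h; have h1 : -1 < alpha + 1 by rewrite (lt_trans h)// ltrDl.
rewrite /Kint -RintegralD//; [|exact: Kfun_integrable..].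
apply: eq_Rintegral => s; rewrite inE/= in_itv/= andbT => s0.
rewrite /Kfun (_ : 1 + m.+1%:R - 1 = (1 + m%:R - 1) + 1); last by rewrite -natr1; ring.
move: (1 + m%:R - 1) (alpha + 1) => q p.
rewrite opprD !powRD ?powRr1 ?powR_inv1 ?(ltW s0)//.
- by field; rewrite gt_eqF// addr_gt0.
- by rewrite addr_ge0// ltW.
- by rewrite (lt0r_neq0 s0) implybT.
- by rewrite lt0r_neq0 ?implybT// addr_gt0.
Qed.

(* Kummer's transformation of the Tricomi function. *)
Lemma Jint_Kint alpha m : -1 < alpha ->
  m`!%:R * Jint alpha m = Gamma (alpha + 1) * Kint alpha m.
Proof.
move=> h; have h1 : 0 < alpha + 1 by rewrite -ltrBlDr sub0r.
have : 0 <= m`!%:R :> R by exact: ler0n.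
move: m`!%:R (Gamma_nat (R := R) m) => c Gm c0.
apply: EFin_inj; rewrite 2!EFinM (JintE _ h) (KintE _ h).
rewrite (ge0_integral_EFinZl c0 (@measurable_Jfun alpha m _) (Jfun_ge0 alpha m)).
rewrite (ge0_integral_EFinZl (ltW (Gamma_gt0 h1)) (@measurable_Kfun alpha m _) (Kfun_ge0 alpha m)).
(* Both sides are iterated integrals of this function, since s + t + st equals s + (1+s)t and also t
   + (1+t)s: integrating in t first gives m! J, in s first Gamma(alpha+1) K. *)
pose f (s t : R) := s `^ (alpha + 1 - 1) * t `^ (m.+1%:R - 1) * expR (- (s + t + s * t)).
transitivity (\int[mu]_(s in `]0%R, +oo[) \int[mu]_(t in `]0%R, +oo[) (f s t)%:E)%E.
  apply: eq_integral => s; rewrite inE/= in_itv/= andbT => s0.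
  transitivity ((s `^ alpha * expR (- s))%:E * egamma (1 + s) m.+1%:R)%E.
    rewrite egammaE ?addr_gt0// Gm -!EFinM; congr EFin.
    by rewrite /Jfun; ring.
  rewrite /egamma ge0_integral_EFinZl.
  - apply: eq_integral => t _; rewrite /f; congr EFin.
    rewrite addrK (_ : - (s + t + s * t) = - s + - ((1 + s) * t)); last by ring.
    by rewrite expRD; ring.
  - by rewrite mulr_ge0 ?powR_ge0 ?expR_ge0.
  - exact: egamma_integrand_measurable.
  - by move=> x; rewrite mulr_ge0 ?powR_ge0 ?expR_ge0.
have [||||_ _ ->] := @tonelli_rect R `]0%R, +oo[ `]0%R, +oo[ f _ _ _ _ => //.
- apply: measurable_funM.
    by apply: measurable_funM; exact: measurable_powR_comp.
  apply: measurable_expR_comp; apply: measurableT_comp => //.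
  by apply: measurable_funD; [exact: measurable_funD|exact: measurable_funM].
- by move=> x y _ _; rewrite !mulr_ge0 ?powR_ge0 ?expR_ge0.
apply: eq_integral => t; rewrite inE/= in_itv/= andbT => t0; apply/esym.
transitivity ((t `^ (m.+1%:R - 1) * expR (- t))%:E * egamma (1 + t) (alpha + 1))%E.
  rewrite (egammaE (addr_gt0 ltr01 t0) h1) -!EFinM; congr EFin.
  by rewrite /Kfun -natr1 [1 + m%:R]addrC mul1r; ring.
rewrite /egamma ge0_integral_EFinZl.
- apply: eq_integral => s _; rewrite /f; congr EFin.
  rewrite (_ : - (s + t + s * t) = - t + - ((1 + t) * s)); last by ring.
  by rewrite expRD; ring.
- by rewrite mulr_ge0 ?powR_ge0 ?expR_ge0.
- exact: egamma_integrand_measurable.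
- by move=> x; rewrite mulr_ge0 ?powR_ge0 ?expR_ge0.
Qed.

Lemma Jint_rec alpha m : -1 < alpha ->
  m.+1`!%:R * Jint alpha m.+1 =
  m`!%:R * Jint (alpha + 1) m - (alpha - m%:R) * (m`!%:R * Jint alpha m).
Proof.
move=> h; have h0 : 0 < alpha + 1 by rewrite -ltrBlDr sub0r.
have h1 : -1 < alpha + 1 by rewrite (lt_trans h)// ltrDl.
(* The three K integrals of [Kint_split] are translated into J(alpha,m), J(alpha+1,m) and
   J(alpha+1,m+1); [Jint_split] then trades the last one for J(alpha,m+1). *)
have K1 := Jint_Kint m h; have K2 := Jint_Kint m h1; have K3 := Jint_Kint m.+1 h1.
have fS : m.+1`!%:R = m.+1%:R * m`!%:R :> R by rewrite factS natrM.
rewrite (GammaS h0) in K2 K3; rewrite fS -natr1 in K3 *.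
have e1 := Jint_split m h.
have e2 := Kint_split m h.
move: m`!%:R K1 K2 K3 => c K1 K2 K3.
rewrite e2 in K1; move: K1 K2 K3 e1.
move: (Jint alpha m) (Jint alpha m.+1) (Jint (alpha + 1) m) => j0 j1 j2.
move: (Jint (alpha + 1) m.+1) (Kint (alpha + 1) m) (Kint (alpha + 1) m.+1) => j3 k2 k3.
move: (Gamma (alpha + 1)) => G K1 K2 K3 e1.
have -> : (m%:R + 1) * c * j1 = (m%:R + 1) * (c * j0) - (m%:R + 1) * c * j3.
  by rewrite e1; ring.
by rewrite K3 K2 K1; ring.
Qed.

(** Writing x / t as x times a power of t lets measurability follow from that of powers; the two
    agree for t > 0. *)
Lemma measurable_rho_integrand (nu x : R) (D : set R) :
  measurable_fun D (fun t => t `^ (nu - 1) * expR (- t - x * t `^ (- 1))).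
Proof.
apply: measurable_funTS; apply: measurable_funM; first exact: measurable_powR.
apply: measurable_expR_comp; apply: measurable_funB => //.
by apply: measurable_funM => //; exact: measurable_powR.
Qed.

Lemma rho_integrable (nu x : R) : -1 < nu -> 0 < x ->
  mu.-integrable `]0, +oo[ (fun t => (t `^ (nu - 1) * expR (- t - x * t `^ (- 1)))%:E).
Proof.
move=> h x0.
have int : mu.-integrable `]0, +oo[
    (fun t => (x^-1)%:E * (t `^ nu * expR (- (1 * t)))%:E)%E.
  by apply: integrableZl => //; exact: gamma_integrable.
apply: (le_integrable _ _ _ int) => //.
  by apply/measurable_EFinP; exact: measurable_rho_integrand.
move=> t /=; rewrite in_itv/= andbT => t0.
have xt0 : 0 < x / t by rewrite divr_gt0.
rewrite !ger0_norm ?mulr_ge0 ?powR_ge0 ?expR_ge0 ?invr_ge0 ?(ltW x0)// lee_fin mul1r.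
rewrite powR_inv1 ?(ltW t0)// expRD powRB ?powRr1 ?(ltW t0)//; last by rewrite (lt0r_neq0 t0) implybT.
(* From e^y >= 1 + y >= y with y = x/t. This gains the factor t that makes t^{nu-1} integrable at 0
   for every nu > -1. *)
have : expR (- (x / t)) <= t / x.
  rewrite expRN -[t / x]invf_div lef_pV2 ?posrE ?expR_gt0//.
  by apply: le_trans (expR_ge1Dx _); rewrite lerDr.
move=> /(ler_wpM2l (mulr_ge0 (powR_ge0 t nu) (expR_ge0 (- t)))).
move=> /(ler_wpM2r (ltW (_ : 0 < t^-1))); rewrite invr_gt0 => /(_ t0).
by congr (_ <= _); [ring|field; rewrite !gt_eqF].
Qed.

Lemma rhoE (nu x : R) : -1 < nu -> 0 < x ->
  ((rho nu x)%:E =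
   \int[mu]_(t in `]0%R, +oo[) (t `^ (nu - 1) * expR (- t - x * t `^ (- 1)))%:E)%E.
Proof.
move=> h x0; rewrite -[RHS]fineK; last first.
  by apply: integrable_fin_num => //; exact: rho_integrable.
congr (fine _)%:E; apply: eq_integral => t; rewrite inE/= in_itv/= andbT => t0.
by rewrite powR_inv1// ltW.
Qed.

Definition weight (nu x : R) : R := expR (- x) * rho nu x.

Lemma weight_ge0 nu x : 0 <= weight nu x.
Proof.
rewrite mulr_ge0 ?expR_ge0// Rintegral_ge0// => t _.
by rewrite mulr_ge0 ?powR_ge0 ?expR_ge0.
Qed.

(** Insert the integral for rho and integrate in x first: the rate 1 + 1/t gives j! (1 +
    1/t)^{-j-1}, and t^{nu-1} absorbs t^{j+1}, leaving the integrand of J(nu+j,j). Finiteness of the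
    result also yields integrability. *)
Lemma weight_moment (nu : R) j : -1 < nu ->
  mu.-integrable `]0, +oo[ (fun x => (x ^+ j * weight nu x)%:E) /\
  \int[mu]_(x in `]0, +oo[) (x ^+ j * weight nu x) = j`!%:R * Jint (nu + j%:R) j.
Proof.
move=> h.
have hj : -1 < nu + j%:R by rewrite (lt_le_trans h)// lerDl.
pose f (x t : R) := x `^ (j.+1%:R - 1) * expR (- x) *
                    (t `^ (nu - 1) * expR (- t - x * t `^ (- 1))).
have mI := measurable_itv (`]0, +oo[ : interval R).
have mf : measurable_fun [set: R * R] (fun z => f z.1 z.2).
  apply: measurable_funM; apply: measurable_funM.
  - exact: measurable_powR_comp.
  - by apply: measurable_expR_comp; exact: measurableT_comp.
  - exact: measurable_powR_comp.
  - apply: measurable_expR_comp; apply: measurable_funB; first exact: measurableT_comp.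
    by apply: measurable_funM => //; exact: measurable_powR_comp.
have f0 x t : (`]0, +oo[%classic : set R) x -> (`]0, +oo[%classic : set R) t -> 0 <= f x t.
  by move=> _ _; rewrite !mulr_ge0 ?powR_ge0 ?expR_ge0.
have [mF _ tonelli] := tonelli_rect mI mI mf f0.
have FE (x : R) : 0 < x ->
    ((x ^+ j * weight nu x)%:E = \int[mu]_(t in `]0%R, +oo[) (f x t)%:E)%E.
  move=> x0.
  rewrite /f -ge0_integral_EFinZl; last 3 first.
  - by rewrite mulr_ge0 ?powR_ge0 ?expR_ge0.
  - exact: measurable_rho_integrand.
  - by move=> t; rewrite mulr_ge0 ?powR_ge0 ?expR_ge0.
  rewrite -(rhoE h x0) -EFinM -natr1 addrK (powR_mulrn _ (ltW x0)) /weight.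
  by rewrite mulrA.
have IE : (\int[mu]_(x in `]0%R, +oo[) (x ^+ j * weight nu x)%:E =
    (j`!%:R * Jint (nu + j%:R) j)%:E)%E.
  transitivity (\int[mu]_(x in `]0%R, +oo[) \int[mu]_(t in `]0%R, +oo[) (f x t)%:E)%E.
    by apply: eq_integral => x; rewrite inE/= in_itv/= andbT; exact: FE.
  rewrite tonelli EFinM (JintE _ hj) ge0_integral_EFinZl; last 3 first.
  - exact: ler0n.
  - exact: measurable_Jfun.
  - exact: Jfun_ge0.
  apply: eq_integral => t; rewrite inE/= in_itv/= andbT => t0.
  have c0 : 0 < 1 + t^-1 by rewrite addr_gt0 ?invr_gt0.
  transitivity ((t `^ (nu - 1) * expR (- t))%:E * egamma (1 + t^-1) j.+1%:R)%E.
    rewrite /egamma ge0_integral_EFinZl.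
    - apply: eq_integral => x _; rewrite /f; congr EFin.
      rewrite (powR_inv1 (ltW t0)).
      rewrite (_ : - ((1 + t^-1) * x) = - x - x / t); last by ring.
      by rewrite !expRD; ring.
    - by rewrite mulr_ge0 ?powR_ge0 ?expR_ge0.
    - exact: egamma_integrand_measurable.
    - by move=> x; rewrite mulr_ge0 ?powR_ge0 ?expR_ge0.
  rewrite (egammaE c0 (ltr0Sn _ j)) Gamma_nat -!EFinM; congr EFin.
  move: j`!%:R => c.
  rewrite /Jfun (_ : 1 + t^-1 = (1 + t) * t `^ (-1)); last first.
    by rewrite (powR_inv1 (ltW t0)); field; rewrite gt_eqF.
  rewrite (powRM _ (addr_ge0 ler01 (ltW t0)) (powR_ge0 _ _)).
  rewrite -powRrM mulN1r opprK.
  rewrite (_ : nu + j%:R = nu - 1 + j.+1%:R); last by rewrite -natr1; ring.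
  rewrite [t `^ (_ + j.+1%:R)]powRD; last by rewrite (lt0r_neq0 t0) implybT.
  by ring.
split; last by rewrite /Rintegral IE.
apply/integrableP; split.
  (* The weight is measurable as a partial integral of the double integrand, by [tonelli_rect]. *)
  apply: eq_measurable_fun mF => x; rewrite inE/= in_itv/= andbT => x0.
  exact/esym/FE.
rewrite (@eq_integral _ _ _ mu _ (fun x => (x ^+ j * weight nu x)%:E)).
  by rewrite IE ltry.
move=> x; rewrite inE/= in_itv/= andbT => x0.
by rewrite /= (ger0_norm (mulr_ge0 (exprn_ge0 j (ltW x0)) (weight_ge0 nu x))).
Qed.
End WeightMoments.

(** * Identification of d_{k,m} with a scaled moment *)

Section CoefficientsAsMoments.
Context {R : realType}.
Implicit Type nu : R.

(** The closed form found in [weight_moment], chosen as the definition so that [Jint_rec] applies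
    directly. *)
Definition moment nu j : R := j`!%:R * Jint (nu + j%:R) j.

Lemma pochhammerS nu k : pochhammer nu k.+1 = pochhammer nu k * (nu + k%:R).
Proof. by rewrite /pochhammer big_ord_recr. Qed.

Lemma pochhammer_neq0 nu k : -1 < nu -> pochhammer (1 + nu) k != 0.
Proof.
move=> h; apply/prodf_neq0 => i _; rewrite gt_eqF//.
by rewrite ltr_wpDr// -ltrBlDl sub0r.
Qed.

(* (-1)^k times the coefficients of k! L_k^nu, the Laguerre polynomial that
   Rodrigues' formula attaches to the weight s^nu e^{-s}. *)
Definition rodrigues nu k r : R :=
  (-1) ^+ (k + r) * 'C(k, r)%:R * (pochhammer (1 + nu) k / pochhammer (1 + nu) r).

Lemma rodriguesS0 nu k :
  rodrigues nu k.+1 0 = - (nu + k%:R + 1) * rodrigues nu k 0.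
Proof.
rewrite /rodrigues !bin0 !addn0 pochhammerS exprS.
by rewrite {2 4}/pochhammer big_ord0; field.
Qed.

Lemma rodriguesSS nu k r : -1 < nu -> (r <= k)%N ->
  rodrigues nu k.+1 r.+1 =
  rodrigues nu k r - (nu + k%:R + r.+1%:R + 1) * rodrigues nu k r.+1.
Proof.
move=> h rk; rewrite /rodrigues !pochhammerS binS natrD addSn addnS !exprS.
have r0 : r%:R + 1 != 0 :> R by rewrite natr1 pnatr_eq0.
(* Everything is expressed through one binomial coefficient; at r = k both sides are 0. *)
have e : 'C(k, r.+1)%:R = (k%:R - r%:R) * 'C(k, r)%:R / (r%:R + 1) :> R.
  by rewrite -natrB// natr1 -natrM -mul_bin_left natrM mulrAC divff ?mul1r// -natr1.
have p0 := pochhammer_neq0 r h.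
have p1 : 1 + nu + r%:R != 0.
  by have := pochhammer_neq0 r.+1 h; rewrite pochhammerS mulf_eq0 negb_or => /andP[].
by rewrite e -natr1; field; rewrite r0 p0 p1.
Qed.

(** Induction on k for all m: one unit moves from k to m, and [Jint_rec] is applied to each term,
    where alpha - m becomes nu + k + r + 1. Collecting terms gives the recurrences [rodriguesS0] and
    [rodriguesSS]. *)
Lemma rodrigues_moment nu k m : -1 < nu ->
  moment nu (k + m) =
  \sum_(r < k.+1) rodrigues nu k r *
    (m`!%:R * Jint (nu + k%:R + r%:R + m%:R) m).
Proof.
move=> h; elim: k m => [|k IH] m.
  rewrite big_ord_recr big_ord0 /= /rodrigues bin0 /pochhammer !big_ord0.
  by rewrite /moment !addr0 add0n expr0 divr1 !mul1r add0r.
pose g r : R := m`!%:R * Jint (nu + k.+1%:R + r%:R + m%:R) m.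
rewrite addSnnS IH.
transitivity (\sum_(r < k.+1) (rodrigues nu k r * g r.+1
    - (nu + k%:R + r%:R + 1) * rodrigues nu k r * g r)).
  apply: eq_bigr => r _; rewrite Jint_rec; last first.
    by rewrite -!addrA (lt_le_trans h)// lerDl !addr_ge0.
  rewrite /g -![_.+1%:R]natr1.
  rewrite (_ : nu + k%:R + r%:R + (m%:R + 1) + 1 =
               nu + (k%:R + 1) + (r%:R + 1) + m%:R); last by ring.
  rewrite (_ : nu + k%:R + r%:R + (m%:R + 1) =
               nu + (k%:R + 1) + r%:R + m%:R); last by ring.
  by ring.
rewrite sumrB [RHS]big_ord_recl /= -/(g 0%N).
rewrite rodriguesS0.
under [X in _ = _ + X]eq_bigr => r _.
  rewrite /bump /= add1n -/(g r.+1) rodriguesSS// ?mulrBl; last by rewrite -ltnS.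
  over.
rewrite sumrB [X in _ - X = _]big_ord_recl.
(* The two sums differ by the term of index k + 1, which vanishes because the binomial coefficient
   is 0. *)
rewrite [X in _ + (_ - X)]big_ord_recr /= [rodrigues nu k k.+1]/rodrigues bin_small//.
by rewrite addr0 /bump /=; under [X in _ - (_ + X) = _]eq_bigr do rewrite add1n; ring.
Qed.

Lemma dcoefE nu k m : -1 < nu ->
  dcoef nu k m = Gamma (1 + nu) * moment nu (k + m) / m`!%:R.
Proof.
move=> h; rewrite /dcoef rodrigues_moment// -mulrA mulr_suml; congr (_ * _).
apply: eq_bigr => r _; rewrite -/(rodrigues nu k r) -!mulrA; congr (_ * _).
have m0 : m`!%:R != 0 :> R by rewrite pnatr_eq0 -lt0n fact_gt0.
have h1 : -1 < nu + k%:R + r%:R + m%:R.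
  by rewrite -!addrA (lt_le_trans h)// lerDl !addr_ge0.
set alpha := nu + k%:R + r%:R + m%:R in h1 *.
(* With a = 1 + m and b = 1 - nu - k - r, the exponent b - a - 1 is -(alpha + 1). *)
have -> : tricomi (1 + m%:R) (1 - nu - k%:R - r%:R) 1 = (m`!%:R)^-1 * Kint alpha m.
  rewrite /tricomi (_ : Gamma _ = m`!%:R); last by rewrite addrC natr1 Gamma_nat.
  congr (_ * _); apply: eq_Rintegral => t _; rewrite /Kfun; congr (_ * _ `^ _).
  by rewrite /alpha; ring.
rewrite (_ : 1 + nu + k%:R + r%:R + m%:R = alpha + 1); last by rewrite /alpha; ring.
have := Jint_Kint m h1; move: (m`!%:R) (Jint alpha m) (Kint alpha m) m0 => c j0 k0 c0 E.
by have -> : Gamma (alpha + 1) * (c^-1 * k0) = c * (j0 / c) by rewrite mulrCA -E; field.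
Qed.
End CoefficientsAsMoments.

(** * The linear functional on polynomials with prescribed moments *)

Section MomentFunctional.
Context {R : realFieldType}.
Variable mom : nat -> R.

Definition mfunctional (p : {poly R}) : R^o := \sum_(i < size p) p`_i * mom i.

Lemma mfunctionalE n (p : {poly R}) : (size p <= n)%N ->
  mfunctional p = \sum_(i < n) p`_i * mom i.
Proof.
move=> pn; rewrite /mfunctional (big_ord_widen n (fun i => p`_i * mom i) pn).
rewrite big_mkcond; apply: eq_bigr => i _; case: ltnP => // /(nth_default 0) ->.
by rewrite mul0r.
Qed.

Lemma mfunctional_is_linear : linear mfunctional.
Proof.
move=> c p q; pose n := maxn (size p) (size q).
rewrite (@mfunctionalE n p) ?leq_maxl// (@mfunctionalE n q) ?leq_maxr//.
rewrite (@mfunctionalE n); last first.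
  by rewrite (leq_trans (size_polyD _ _))// geq_max leq_maxr (leq_trans (size_scale_leq _ _)) ?leq_maxl.
rewrite scaler_sumr -big_split; apply: eq_bigr => i _.
by rewrite coefD coefZ mulrDl -mulrA.
Qed.

HB.instance Definition _ :=
  GRing.isLinear.Build R {poly R} R^o _ mfunctional mfunctional_is_linear.

Lemma mfunctionalXn n : mfunctional 'X^n = mom n.
Proof.
rewrite (@mfunctionalE n.+1) ?size_polyXn// big_ord_recr /= coefXn eqxx mul1r.
rewrite big1 ?add0r// => i _; rewrite coefXn ltn_eqF ?mul0r//.
Qed.

Lemma mfunctionalMXn n (p : {poly R}) m : (size p <= n)%N ->
  mfunctional (p * 'X^m) = \sum_(i < n) p`_i * mom (i + m).
Proof.
move=> pn; rewrite -{1}[p](coefK) poly_def mulr_suml linear_sum.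
rewrite (big_ord_widen n (fun i => mfunctional (p`_i *: 'X^i * 'X^m)) pn).
rewrite big_mkcond; apply: eq_bigr => i _; case: ltnP => [_|/(nth_default 0) ->].
  by rewrite -scalerAl -exprD linearZ /= mfunctionalXn.
by rewrite mul0r.
Qed.

End MomentFunctional.

(** * Orthonormal polynomials for an abstract linear functional *)

Section Orthonormal.
Context {R : realFieldType}.
Variables (L : {linear {poly R} -> R^o}) (P : nat -> {poly R}).
Hypothesis szP : forall n, size (P n) = n.+1.
Hypothesis orthoP : forall m n, L (P m * P n) = (m == n)%:R.

Lemma orthonormal_span n (p : {poly R}) : (size p <= n)%N ->
  exists c : nat -> R, p = \sum_(i < n) c i *: P i.
Proof.
elim: n p => [|n IH] p pn.
  by exists (fun=> 0); rewrite big_ord0; apply/eqP; rewrite -size_poly_leq0.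
have l0 : (P n)`_n != 0.
  by have := lead_coef_eq0 (P n); rewrite lead_coefE szP -size_poly_eq0 szP => ->.
pose b := (p`_n / (P n)`_n)%R.
have /IH[c qE] : (size (p - b *: P n)%R <= n)%N.
  apply/leq_sizeP => j; rewrite leq_eqVlt => /predU1P[<-|nj].
    by rewrite coefB coefZ /b divfK// subrr.
  rewrite coefB coefZ !nth_default ?mulr0 ?subr0// ?szP//.
  exact: leq_trans nj.
exists (fun i => if i == n then b else c i).
rewrite big_ord_recr /= eqxx -[LHS](subrK (b *: P n)) qE; congr (_ + _).
by apply: eq_bigr => i _; rewrite ltn_eqF.
Qed.

Lemma orthonormal_low n (q : {poly R}) : (size q <= n)%N -> L (P n * q) = 0.
Proof.
move=> /orthonormal_span[c ->]; rewrite mulr_sumr linear_sum big1// => i _.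
by rewrite -scalerAr linearZ /= orthoP gtn_eqF// scaler0.
Qed.

(** Parseval: expanding p in the P_i makes L(p^2) the sum of the squared coefficients. Strict
    positivity thus comes from the existence of the orthonormal sequence, not from the weight. *)
Lemma orthonormal_sqr_gt0 (p : {poly R}) : p != 0 -> 0 < L (p * p) :> R.
Proof.
have [n [c pE]] : exists n (c : nat -> R), p = \sum_(i < n) c i *: P i.
  by exists (size p); exact: orthonormal_span.
have -> : L (p * p) = \sum_(i < n) c i ^+ 2 :> R.
  rewrite {2}pE mulr_sumr linear_sum; apply: eq_bigr => i _.
  rewrite -scalerAr linearZ /= {1}pE mulr_suml linear_sum.
  rewrite (bigD1 i)//= -scalerAl linearZ /= orthoP eqxx big1 ?addr0.
    by rewrite /GRing.scale /= mulr1 expr2.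
  move=> j ji; rewrite -scalerAl linearZ /= orthoP.
  by rewrite (_ : _ == _ = false) ?scaler0//; apply/negbTE.
move=> p0; rewrite lt0r sumr_ge0 ?andbT => [|i _]; last exact: sqr_ge0.
apply: contra p0; rewrite psumr_eq0 => [|i _]; last exact: sqr_ge0.
move=> /allP c0; rewrite pE big1// => i _.
by have /eqP := c0 i (mem_index_enum _); move=> /eqP; rewrite sqrf_eq0 => /eqP ->; rewrite scale0r.
Qed.

(* By Cauchy-Schwarz for the semi-definite form L(X p q), L(X p^2) = 0 forces
   L((X p)^2) = 0. *)
Lemma orthonormal_X_neq0 (p : {poly R}) :
  (forall q : {poly R}, 0 <= L ('X * (q * q)) :> R) -> p != 0 ->
  L ('X * (p * p)) != 0.
Proof.
move=> posX p0; apply/eqP => Lp.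
pose b : R := L ('X * p * ('X * p)); pose c : R := L ('X * ('X * p * ('X * p))).
have b0 : 0 < b by apply: orthonormal_sqr_gt0; rewrite mulf_neq0// polyX_eq0.
have c0 : 0 <= c by exact: posX.
(* Near the minimizer -b/c of 2tb + t^2 c, but defined also when c = 0; the value is -b^2
   (c+2)/(c+1)^2 < 0. *)
pose t := - (b / (c + 1)).
have := posX (p + t *: ('X * p)).
have -> : 'X * ((p + t *: ('X * p)) * (p + t *: ('X * p))) =
  'X * (p * p) + ((2 * t) *: ('X * p * ('X * p)) + t ^+ 2 *: ('X * ('X * p * ('X * p)))).
  by rewrite -!mul_polyC rmorphM rmorphXn /= !rmorphD/= rmorph1; ring.
rewrite !linearD !linearZ /= Lp -/b -/c /GRing.scale /= add0r.
rewrite (_ : _ + _ = - (b ^+ 2 * (c + 2) / (c + 1) ^+ 2)); last first.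
  by rewrite /t; field; rewrite gt_eqF// ltr_wpDl.
by rewrite leNgt oppr_lt0 divr_gt0 ?mulr_gt0 ?exprn_gt0// ltr_wpDl.
Qed.

Variable a : nat -> nat -> R.
Hypothesis PE : forall n, P n = \poly_(k < n.+1) a n k.
Hypothesis a_gt0 : forall n, 0 < a n n.

Lemma orthonormal_top n (q : {poly R}) : (size q <= n.+1)%N ->
  L (P n * q) = q`_n / a n n.
Proof.
move=> qn; pose b := (q`_n / a n n)%R.
have n0 : a n n != 0 by rewrite gt_eqF.
have sz : (size (q - b *: P n)%R <= n)%N.
  apply/leq_sizeP => j; rewrite leq_eqVlt => /predU1P[<-|nj].
    by rewrite coefB coefZ PE coef_poly ltnSn /b divfK// subrr.
  rewrite coefB coefZ !nth_default ?mulr0 ?subr0// ?szP//.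
  exact: leq_trans nj.
rewrite -[q in LHS](subrK (b *: P n)) mulrDr linearD /= (orthonormal_low sz) add0r.
by rewrite -scalerAr linearZ /= orthoP eqxx /GRing.scale /= mulr1.
Qed.

(** The first two coefficients cancel degrees n + 1 and n, so the difference [Q] of the two sides
    has degree below n. It is also orthogonal to all such polynomials, hence to itself, and is 0. *)
Lemma orthonormal_recurrence n :
  let P' := if n is n'.+1 then (a n' n' / a n n) *: P n' else 0 in
  let c := (if n is n'.+1 then a n n' else 0) / a n n - a n.+1 n / a n.+1 n.+1 in
  'X * P n = (a n n / a n.+1 n.+1) *: P n.+1 + c *: P n + P'.
Proof.
move=> P' c; apply/eqP; rewrite -subr_eq0; set Q := _ - _.
have n0 m : a m m != 0 by rewrite gt_eqF.
have P'n : (size P' <= n)%N.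
  rewrite /P'; case: (n) => [|n']; first by rewrite size_poly0.
  by rewrite (leq_trans (size_scale_leq _ _))// szP.
have szQ : (size Q <= n)%N.
  apply/leq_sizeP => j nj; rewrite /Q coefB !coefD !coefZ coefXM [P'`_j]nth_default ?addr0; last exact: leq_trans nj.
  rewrite !PE !coef_poly; move: nj; rewrite leq_eqVlt => /predU1P[<-|].
    rewrite ltnSn ltnS leqnSn /c; case: (n) => [|n'] /=.
      by field; rewrite !n0.
    by rewrite leqnSn /=; field; rewrite !n0.
  rewrite leq_eqVlt => /predU1P[<-|nj] /=.
    by rewrite !ltnSn ltnn; field; rewrite !n0.
  case: j nj => // j; rewrite ltnS => nj /=.
  have f1 : (j < n.+1)%N = false by rewrite ltnNge nj.
  have f2 : (j.+1 < n.+2)%N = false by [].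
  have f3 : (j.+1 < n.+1)%N = false by rewrite ltnNge (leqW nj).
  by rewrite f1 f2 f3; ring.
(* Moving X onto q leaves L(P_n X q) = q_{n-1} / a_{n,n} by [orthonormal_top], which the P_{n-1}
   term matches exactly. *)
have orthoQ (q : {poly R}) : (size q <= n)%N -> L (Q * q) = 0.
  move=> qn; rewrite /Q ['X * _]mulrC mulrBl !mulrDl linearB !linearD /=.
  rewrite -[P n * 'X * q]mulrA -!scalerAl !linearZ /=.
  rewrite (orthonormal_low (leqW qn)) (orthonormal_low qn) !oppr0 !scaler0 !add0r.
  rewrite /P'; case: (n) qn => [|n'] qn.
    by move: qn; rewrite size_poly_leq0 => /eqP ->; rewrite !mulr0 linear0 subrr.
  rewrite orthonormal_top; last first.
    by rewrite (leq_trans (size_polyMleq _ _))// size_polyX addnC addn2 /= ltnS.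
  rewrite -scalerAl linearZ /= orthonormal_top// coefXM /GRing.scale /=.
  by field; rewrite !n0.
by apply/negPn/negP => /orthonormal_sqr_gt0; rewrite orthoQ// ltxx.
Qed.
End Orthonormal.

(** Cramer's rule without division: along column j0 the cofactors of B are those of A, so the
    expansion is the j0 entry of adj(A) A x = det(A) x. *)
Lemma cramer_col {R : comPzRingType} n (A B : 'M[R]_n) (x : 'cV[R]_n) c j0 :
  (forall i, c * B i j0 = (A *m x) i 0) ->
  (forall i j, j != j0 -> B i j = A i j) ->
  c * \det B = x j0 0 * \det A.
Proof.
move=> Bj0 BE; have cofE i : cofactor B i j0 = cofactor A i j0.
  rewrite /cofactor; congr (_ * \det _); apply/matrixP => k l.
  by rewrite !mxE BE // eq_sym neq_lift.
rewrite (expand_det_col B j0) mulr_sumr.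
transitivity ((\adj A *m (A *m x)) j0 0).
  rewrite [RHS]mxE; apply: eq_bigr => i _.
  by rewrite mulrA Bj0 cofE [\adj A _ _]mxE mulrC.
by rewrite mulmxA mul_adj_mx mul_scalar_mx mxE mulrC.
Qed.

(** * Determinant formulas for the coefficients *)

Section Determinants.
Context {R : realType}.
Local Notation mu := (@lebesgue_measure R).
Implicit Type nu : R.

(** Links the integral to the algebraic functional. The induction on partial sums carries
    integrability along, because additivity of the integral needs it. *)
Lemma horner_weight nu (p : {poly R}) : -1 < nu ->
  \int[mu]_(x in `]0, +oo[) (p.[x] * weight nu x) = mfunctional (moment nu) p.
Proof.
move=> h.
have wint j := (weight_moment j h).1.
have wE j : \int[mu]_(x in `]0, +oo[) (x ^+ j * weight nu x) = moment nu j.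
  exact: (weight_moment j h).2.
pose S n x := \sum_(i < n) p`_i * (x ^+ i * weight nu x).
have S0 : S 0%N = cst 0 by apply/funext => x; rewrite /S big_ord0.
have SS n : S n.+1 = (fun x => S n x + p`_n * (x ^+ n * weight nu x)).
  by apply/funext => x; rewrite /S big_ord_recr.
have sumE n : mu.-integrable `]0, +oo[ (EFin \o S n) /\
    \int[mu]_(x in `]0, +oo[) S n x = \sum_(i < n) p`_i * moment nu i.
  elim: n => [|n [IH1 IH2]].
    rewrite S0 big_ord0; split; first exact: integrable0.
    by rewrite /Rintegral integral0.
  have intn : mu.-integrable `]0, +oo[
      (EFin \o (fun x => p`_n * (x ^+ n * weight nu x))).
    by apply: (integrableZl _ p`_n (wint n)).
  rewrite SS big_ord_recr /= -IH2 -(wE n) -RintegralZl ?RintegralD//; last exact: wint.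
  by split; first exact: (integrableD _ IH1 intn).
rewrite /mfunctional -(sumE (size p)).2; apply: eq_Rintegral => x _.
by rewrite /S horner_coef mulr_suml; apply: eq_bigr => i _; rewrite -mulrA.
Qed.

Variables (nu : R) (P : nat -> {poly R}) (a : nat -> nat -> R).
Hypotheses (hnu : -1 < nu) (PE : forall n, P n = \poly_(k < n.+1) a n k)
  (a_gt0 : forall n, 0 < a n n)
  (hortho : orthonormal_for (weight nu) P).

Let L := mfunctional (moment nu).
Let g : R := Gamma (1 + nu).

Let g_gt0 : 0 < g.
Proof. by apply: Gamma_gt0; rewrite -ltrBlDl sub0r. Qed.

Let szP n : size (P n) = n.+1.
Proof. by rewrite PE size_poly_eq// gt_eqF. Qed.

Let orthoP m n : L (P m * P n) = (m == n)%:R.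
Proof.
rewrite /L -(horner_weight _ hnu) eq_sym -hortho.
by apply: eq_Rintegral => x _; rewrite hornerM.
Qed.

Let posX (q : {poly R}) : 0 <= L ('X * (q * q)) :> R.
Proof.
rewrite /L -(horner_weight _ hnu); apply: Rintegral_ge0 => x /=.
rewrite in_itv/= andbT => x0; rewrite !hornerM hornerX.
by rewrite mulr_ge0 ?weight_ge0// mulr_ge0 ?(ltW x0)// -expr2 sqr_ge0.
Qed.

Let dE k m : dcoef nu k m = g / m`!%:R * moment nu (k + m).
Proof. by rewrite dcoefE// mulrAC. Qed.

Let coefP n k : (k <= n)%N -> (P n)`_k = a n k.
Proof. by move=> kn; rewrite PE coef_poly ltnS kn. Qed.

(** A kernel vector is the coefficient vector of a nonzero p of degree below n with L(X p X^m) = 0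
    for all m < n. Then L(X p^2) = 0, against [orthonormal_X_neq0]. *)
Lemma Ddet_neq0 n : Ddet nu n != 0.
Proof.
rewrite /Ddet -det_tr; apply/negP => /det0P[v v0 vA].
(* The default 0 is never reached, as the indices stay below n. *)
pose p := \poly_(i < n) oapp (v 0) 0 (insub i).
have pE (i : 'I_n) : p`_i = v 0 i.
  by rewrite coef_poly ltn_ord (insubT (fun k => k < n)%N (ltn_ord i)) /=; congr (v _ _); exact: val_inj.
have pn : (size p <= n)%N by exact: size_poly.
have p0 : p != 0.
  apply: contra v0 => /eqP p0; apply/eqP/rowP => i.
  by rewrite mxE -pE p0 coef0.
have LX (m : 'I_n) : L ('X * p * 'X^m) = 0.
  rewrite -mulrA mulrC -mulrA -exprSr /L (mfunctionalMXn _ _ pn).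
  have := congr1 (fun M : 'rV_n => M 0 m) vA; rewrite !mxE => E.
  have c0 : g / m`!%:R != 0.
    by rewrite mulf_neq0 ?gt_eqF// invr_gt0 ltr0n fact_gt0.
  apply: (mulfI c0); rewrite mulr0 -[RHS]E mulr_sumr; apply: eq_bigr => i _.
  rewrite !mxE dE pE addSnnS.
  by rewrite mulrCA.
have := orthonormal_X_neq0 szP orthoP posX p0; move/eqP; apply.
rewrite mulrA -{2}[p](coefK) poly_def mulr_sumr linear_sum /=.
rewrite (big_ord_widen n (fun i => L ('X * p * (p`_i *: 'X^i))) pn) big1// => i _.
by rewrite -scalerAr [L _]linearZ /= [mfunctional _ _]LX scaler0.
Qed.

(** The relations L(P_n X^m) = 0 for m < n, scaled by Gamma(1+nu)/m!, form a linear system for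
    a_{n,1},...,a_{n,n} with matrix (d_{j,m}) and right side -a_{n,0} d_{0,m}. The case k = 0 rests
    on the convention D_{n,0} = -D_n. *)
Lemma coef_Dcol n k : (k <= n)%N ->
  a n k = - a n 0%N * (Dcol nu n k%:Z / Ddet nu n).
Proof.
case: k => [_|k kn]; first by rewrite /= !mulNr mulrN opprK divff ?Ddet_neq0// mulr1.
pose x : 'cV[R]_n := \col_j (a n j.+1).
pose A : 'M[R]_n := \matrix_(m < n, j < n) dcoef nu j.+1 m.
pose B : 'M[R]_n := \matrix_(m < n, j < n)
   if j == k :> nat then dcoef nu 0 m else dcoef nu j.+1 m.
have Ax m : (A *m x) m 0 = - a n 0%N * dcoef nu 0 m.
  have low : L (P n * 'X^m) = 0.
    by apply: (orthonormal_low szP orthoP); rewrite size_polyXn.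
  move: low; rewrite /L (mfunctionalMXn _ _ (eq_leq (szP n))) big_ord_recl coefP//.
  move=> /eqP; rewrite addr_eq0 => /eqP low.
  rewrite dE add0n mulrCA mulNr low opprK mulr_sumr mxE; apply: eq_bigr => j _.
  by rewrite !mxE dE lift0 coefP ?ltn_ord// -mulrA [moment _ _ * _]mulrC.
have := @cramer_col _ n A B x (- a n 0%N) (Ordinal kn).
rewrite !mxE => /(_ _ _)E.
rewrite mulrA E ?mulfK ?Ddet_neq0//.
- by move=> i; rewrite Ax !mxE eqxx.
- by move=> i j; rewrite !mxE -val_eqE /= => /negbTE ->.
Qed.

Lemma a0_neq0 n : a n 0%N != 0.
Proof.
apply/eqP => a0; have := a_gt0 n.
by rewrite (coef_Dcol (leqnn n)) a0 oppr0 mul0r ltxx.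
Qed.

Lemma Dcol_diag_neq0 n : Dcol nu n n%:Z != 0.
Proof.
apply/eqP => D0; have := a_gt0 n.
by rewrite (coef_Dcol (leqnn n)) D0 mul0r mulr0 ltxx.
Qed.

(** Normalization enters as L(P_n X^n) = 1/a_{n,n}. Replacing every coefficient through [coef_Dcol]
    leaves an equation in a_{n,0}^2 alone; since that square is positive, so is the radicand. *)
Lemma a0_sqr n :
  0 < radicand nu n /\ a n 0%N ^+ 2 = Ddet nu n ^+ 2 * radicand nu n.
Proof.
have D0 := Ddet_neq0 n; have g0 : g != 0 by rewrite gt_eqF.
pose S := \sum_(k < n.+1) Dcol nu n k%:Z * moment nu (n + k).
(* The factorial cancels the one dividing the moment in d_{0,n+k}. *)
have SE : \sum_(k < n.+1) (Dcol nu n k%:Z * (n + k)`!%:R * dcoef nu 0 (n + k)) = g * S.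
  rewrite /S mulr_sumr; apply: eq_bigr => k _; rewrite dE add0n.
  have : (n + k)`!%:R != 0 :> R by rewrite pnatr_eq0 -lt0n fact_gt0.
  move: (n + k)`!%:R (moment nu (n + k)) (Dcol nu n k) => f m d f0.
  by field.
have top : L (P n * 'X^n) = (a n n)^-1.
  have szX : (size ('X^n : {poly R}) <= n.+1)%N by rewrite size_polyXn.
  apply: etrans (orthonormal_top szP orthoP PE a_gt0 szX) _.
  by rewrite coefXn eqxx mul1r.
have E : a n n * (- a n 0%N / Ddet nu n * S) = 1.
  rewrite -[RHS](mulfV (lt0r_neq0 (a_gt0 n))) -top; congr (_ * _).
  rewrite /L (mfunctionalMXn _ _ (eq_leq (szP n))) /S mulr_sumr.
  apply: eq_bigr => k _; have kn : (k <= n)%N by rewrite -ltnS.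
  by rewrite coefP// (coef_Dcol kn) addnC -!mulrA [_^-1 * (_ * _)]mulrCA.
rewrite (coef_Dcol (leqnn n)) in E.
have Dn0 := Dcol_diag_neq0 n; have an0 := a0_neq0 n.
have S0 : S != 0.
  by apply/eqP => S0; move: E; rewrite S0 !mulr0 => /eqP; rewrite eq_sym oner_eq0.
have rE : radicand nu n = (Dcol nu n n%:Z * S)^-1.
  by rewrite /radicand SE -/g; field; rewrite g0 S0 Dn0.
have sqE : a n 0%N ^+ 2 = Ddet nu n ^+ 2 * radicand nu n.
  by rewrite rE -[_ ^+ 2 in RHS]mulr1 -E; field; rewrite D0 S0 Dn0.
split=> //.
by rewrite -(pmulr_rgt0 _ (_ : 0 < Ddet nu n ^+ 2)) -?sqE ?exprn_even_gt0.
Qed.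

Lemma a0_formula n : exists e : bool,
  let c := (-1) ^+ e * Ddet nu n * Num.sqrt (radicand nu n) in
  a n 0%N = c /\ 0 < - c * (Dcol nu n n%:Z / Ddet nu n).
Proof.
have [r0 sqE] := a0_sqr n.
have [e aE] : exists e : bool,
    a n 0%N = (-1) ^+ e * Ddet nu n * Num.sqrt (radicand nu n).
  have : a n 0%N ^+ 2 = (Ddet nu n * Num.sqrt (radicand nu n)) ^+ 2.
    by rewrite sqE exprMn sqr_sqrtr// ltW.
  move=> /eqP; rewrite eqf_sqr => /predU1P[->|/eqP ->].
    by exists false; rewrite mul1r.
  by exists true; rewrite -mulrA mulN1r.
by exists e; rewrite /= -aE; split=> //; rewrite -coef_Dcol.
Qed.

Lemma three_term (A B : nat -> R) :
  (forall n : nat,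
     A n.+1 = (a n 0%N * Ddet nu n.+1 * Dcol nu n n%:Z)
              / (a n.+1 0%N * Ddet nu n * Dcol nu n.+1 n.+1%:Z)) ->
  (forall n : nat,
     B n = Dcol nu n (n%:Z - 1) / Dcol nu n n%:Z
           - Dcol nu n.+1 n%:Z / Dcol nu n.+1 n.+1%:Z) ->
  forall (n : nat) (x : R),
    x * (P n).[x] = A n.+1 * (P n.+1).[x] + B n * (P n).[x]
                    + A n * (prevp P n).[x].
Proof.
move=> AE BE n x.
have a0 := a0_neq0; have D0 := Ddet_neq0; have Dn0 := Dcol_diag_neq0.
(* By [coef_Dcol] the determinant quotient is the ratio of leading coefficients; likewise [ratio]
   turns B_n into the coefficient [c] of [orthonormal_recurrence]. *)
have AE' m : A m.+1 = a m m / a m.+1 m.+1.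
  rewrite AE (coef_Dcol (leqnn m)) (coef_Dcol (leqnn m.+1)).
  by field; rewrite !a0 !D0 !Dn0.
have ratio m k : (k <= m)%N -> a m k / a m m = Dcol nu m k%:Z / Dcol nu m m%:Z.
  move=> km; rewrite (coef_Dcol (leqnn m)) (coef_Dcol km).
  by field; rewrite !a0 !D0 !Dn0.
have /(congr1 (fun p => p.[x])) := orthonormal_recurrence szP orthoP PE a_gt0 n.
rewrite /= !hornerE => ->; rewrite -AE'; congr (_ + _ + _).
  rewrite BE -(ratio n.+1 n (leqnSn n)); congr ((_ - _) * _).
  (* For n = 0 the convention D_{0,-1} = 0 matches the absent coefficient a_{0,-1}. *)
  case: (n) => [|m]; first by rewrite !mul0r.
  by rewrite (_ : m.+1%:Z - 1 = m%:Z) ?ratio// intS addrC addKr.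
case: (n) => [|m] /=; first by rewrite horner0 mulr0.
by rewrite hornerZ AE'.
Qed.

End Determinants.

Theorem theorem1 (R : realType) (nu : R) (hnu : -1 < nu)
    (P : nat -> {poly R}) (a : nat -> nat -> R)
    (hP : forall n : nat, P n = \poly_(k < n.+1) a n k)
    (hlead : forall n : nat, 0 < a n n)
    (hortho : orthonormal_for (fun x => expR (- x) * rho nu x) P) :
  [/\ (* the denominators and the radicand in the formulas are legitimate *)
      forall n : nat,
        [/\ Ddet nu n != 0, Dcol nu n n%:Z != 0 & 0 < radicand nu n],
      forall n k : nat, (1 <= k <= n)%N ->
        a n k = - a n 0%N * (Dcol nu n k%:Z / Ddet nu n),
      (* the sign (-1)^e is the one making -a_{n,0} D_{n,n} / D_n positive *)
      forall n : nat, exists e : bool,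
        let c := (-1) ^+ e * Ddet nu n * Num.sqrt (radicand nu n) in
        a n 0%N = c /\ 0 < - c * (Dcol nu n n%:Z / Ddet nu n)
    & (* A 0 is unconstrained: it only multiplies P_{-1} = 0 *)
      forall A B : nat -> R,
        (forall n : nat,
           A n.+1 = (a n 0%N * Ddet nu n.+1 * Dcol nu n n%:Z)
                    / (a n.+1 0%N * Ddet nu n * Dcol nu n.+1 n.+1%:Z)) ->
        (forall n : nat,
           B n = Dcol nu n (n%:Z - 1) / Dcol nu n n%:Z
                 - Dcol nu n.+1 n%:Z / Dcol nu n.+1 n.+1%:Z) ->
        forall (n : nat) (x : R),
          x * (P n).[x] = A n.+1 * (P n.+1).[x] + B n * (P n).[x]
                          + A n * (prevp P n).[x] ].
Proof.
split.
- move=> n; split.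
  + exact: (Ddet_neq0 hnu hP hlead hortho).
  + exact: (Dcol_diag_neq0 hnu hP hlead hortho).
  + exact: (a0_sqr hnu hP hlead hortho n).1.
- by move=> n k /andP[_ kn]; exact: (coef_Dcol hnu hP hlead hortho kn).
- exact: (a0_formula hnu hP hlead hortho).
- exact: (three_term hnu hP hlead hortho).
Qed.
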